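(* For every decreasing function $F:\mathbb{R}^+\times\mathbb{N}\to\mathbb{R}^+$ and every $\epsilon>0$ there is a constant $n$ such that for every finite nonempty set $V$ and every symmetric matrix $G:V\times V\to[-1,1]$ there is a decomposition $G=S+E+R$ into matrices $V\times V\to\mathbb{R}$ such that 1. $S$ is a step function with $s\le n$ steps; 2. $\|gSg^{-1}-S\|_\infty\le\epsilon$ for every $g\in\mathrm{Aut}(G)$; 3. $\|E\|_2\le\epsilon$; 4. $\|R\|_\square\le F(\epsilon,s)$.
   Context: ''Decreasing'' means decreasing in each variable. The finite set $V$ carries the uniform probability measure $\mu$, and norms of a matrix $M:V\times V\to\mathbb{R}$ are normalized accordingly: $\|M\|_\infty=\max_{x,y}|M(x,y)|$, $\|M\|_2=\bigl(|V|^{-2}\sum_{x,y}|M(x,y)|^2\bigr)^{1/2}$, and the cut norm is $\|M\|_\square=\sup\bigl| |V|^{-2}\sum_{x,y}\overline{f(x)}M(x,y)g(y)\bigr|$ over all $f,g:V\to\mathbb{C}$ with $|f|,|g|\le 1$ pointwise. For a symmetric matrix $G:V\times V\to\mathbb{R}$, $\mathrm{Aut}(G)$ is the group of permutation matrices $g$ (indexed by $V$) with $gGg^{-1}=G$. A matrix $S:V\times V\to\mathbb{R}$ is a step function with $s$ steps if there are a partition $\{P_1,\dots,P_s\}$ of $V$ and a matrix $T:[s]^2\to\mathbb{R}$ such that $S(a,b)=T(i,j)$ whenever $a\in P_i$, $b\in P_j$. *)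

(* Defs.v *)
From HB Require Import structures.
From mathcomp Require Import all_boot all_order all_algebra all_fingroup.
From mathcomp Require Import all_classical all_reals.
From mathcomp Require Import complex.

Set Implicit Arguments.
Unset Strict Implicit.
Unset Printing Implicit Defensive.

Import Order.TTheory GRing.Theory Num.Theory.

Local Open Scope ring_scope.

(* Matrices indexed by a finite type V are functions V -> V -> R: the type
   'M[R]_n of the library only allows the index sets 'I_n. *)

Definition fmulmx (R : realType) (V : finType) (A B : V -> V -> R) : V -> V -> R :=
  fun x y => \sum_(z : V) A x z * B z y.

(* Same convention as perm_mx. *)
Definition fperm_mx (R : realType) (V : finType) (g : {perm V}) : V -> V -> R :=
  fun x y => (g x == y)%:R.

Lemma fperm_mxM (R : realType) (V : finType) (g h : {perm V}) (x y : V) :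
  fmulmx (fperm_mx R g) (fperm_mx R h) x y = fperm_mx R (g * h)%g x y.
Proof.
rewrite /fmulmx /fperm_mx (bigD1 (g x)) //= eqxx mul1r big1 ?addr0 ?permM //.
by move=> z; rewrite eq_sym => /negPf ->; rewrite mul0r.
Qed.

(* By fperm_mxM, this is the product g M g^-1 of matrices, with g identified
   with its permutation matrix. *)
Definition perm_conj (R : realType) (V : finType) (g : {perm V})
    (M : V -> V -> R) : V -> V -> R :=
  fmulmx (fmulmx (fperm_mx R g) M) (fperm_mx R g^-1%g).

(* Aut(G), each permutation matrix being represented by its permutation. *)
Definition mx_aut (R : realType) (V : finType) (G : V -> V -> R) : set {perm V} :=
  fun g => forall x y : V, perm_conj g G x y = G x y.

Definition mx_norm_inf (R : realType) (V : finType) (M : V -> V -> R) : R :=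
  \big[Num.max/0]_(p : V * V) `|M p.1 p.2|.

Definition mx_norm2 (R : realType) (V : finType) (M : V -> V -> R) : R :=
  Num.sqrt ((#|V|%:R ^- 2) * \sum_(x : V) \sum_(y : V) `|M x y| ^+ 2).

Definition cut_form (R : realType) (V : finType) (M : V -> V -> R)
    (f g : V -> R[i]) : R[i] :=
  (#|V|%:R ^- 2) * \sum_(x : V) \sum_(y : V) (f x)^*%C * (M x y)%:C%C * g y.

(* The norm of R[i] takes values in R[i], hence the projection Re. *)
Definition cut_norm (R : realType) (V : finType) (M : V -> V -> R) : R :=
  sup (fun r : R => exists f g : V -> R[i],
    [/\ forall x : V, `|f x| <= 1,
        forall x : V, `|g x| <= 1 &
        r = complex.Re `|cut_form M f g| ]).

(* The blocks P i are pairwise distinct, so there are exactly s of them, and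
   they are nonempty, as required by partition. *)
Definition is_step_function (R : realType) (V : finType) (s : nat)
    (S : V -> V -> R) : Prop :=
  exists (P : 'I_s -> {set V}) (T : 'I_s -> 'I_s -> R),
    [/\ injective P,
        finset.partition [set P i | i : 'I_s]%SET [set: V]%SET &
        forall (i j : 'I_s) (a b : V), a \in P i -> b \in P j -> S a b = T i j].

(* F is only constrained on positive reals: it stands for a function from
   positive reals and naturals to positive reals, nonincreasing in each
   variable. *)
Definition positive_decreasing (R : realType) (F : R -> nat -> R) : Prop :=
  [/\ forall (e : R) (s : nat), 0 < e -> 0 < F e s,
      forall (e e' : R) (s : nat), 0 < e -> e <= e' -> F e' s <= F e s &
      forall (e : R) (s s' : nat), 0 < e -> (s <= s')%N -> F e s' <= F e s].

(* Main.v *)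
(* With the spectral decomposition G = sum_i d_i u_i (x) u_i, let G_t be the
   part of G carried by the eigenvalues |d_i| >= t |V|. There are at most t^-2
   of them and their eigenvectors are uniformly bounded, so G_t is uniformly
   close to a step function S whose number of steps is bounded in terms of t
   only; and G_t is invariant under Aut(G), which makes S almost invariant. The
   eigenvalues below t' |V| contribute at most t' to the cut norm, so given t
   one takes t' <= F(eps, steps(t)). Since sum_i d_i^2 <= |V|^2, after boundedly many
   iterations of t |-> t' some G_t' - G_t has small L2 norm. *)

Require Import Defs.
From HB Require Import structures.
From mathcomp Require Import all_boot all_order all_algebra all_fingroup.
From mathcomp Require Import all_classical all_reals.
From mathcomp Require Import spectral complex.
From mathcomp Require Import ring lra.

Set Implicit Arguments.
Unset Strict Implicit.
Unset Printing Implicit Defensive.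

Import Order.TTheory GRing.Theory Num.Theory.

Local Open Scope ring_scope.

(** * Orthonormal bases and functional calculus *)

Definition unitary (C : numClosedFieldType) (V : finType) (u : V -> V -> C) :=
  (forall i j, \sum_x u i x * (u j x)^* = (i == j)%:R) /\
  (forall x y, \sum_i (u i x)^* * u i y = (x == y)%:R).

(** With the conjugate on the left factor, for unitary [u] the rows [u i] are left eigenvectors and
    their conjugates right eigenvectors. *)
Definition spectral_sum (C : numClosedFieldType) (V : finType)
    (u : V -> V -> C) (d : V -> C) (x y : V) : C :=
  \sum_i (u i x)^* * d i * u i y.

Lemma sum_delta (C : pzSemiRingType) (V : finType) (i : V) (F : V -> C) :
  \sum_j (i == j)%:R * F j = F i.
Proof.
rewrite (bigD1 i) //= eqxx mul1r big1 ?addr0 // => j.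
by rewrite eq_sym => /negPf ->; rewrite mul0r.
Qed.

(** Assuming a single orthogonality relation lets this serve both the rows of [u] and its
    transpose. *)
Lemma parseval (C : numClosedFieldType) (V : finType) (u : V -> V -> C)
    (a : V -> C) :
  (forall i j, \sum_x u i x * (u j x)^* = (i == j)%:R) ->
  \sum_x `|\sum_i a i * u i x| ^+ 2 = \sum_i `|a i| ^+ 2.
Proof.
move=> hu.
transitivity (\sum_x \sum_i \sum_j a i * (a j)^* * (u i x * (u j x)^*)).
  apply: eq_bigr => x _; rewrite normCK rmorph_sum mulr_suml.
  apply: eq_bigr => i _; rewrite mulr_sumr; apply: eq_bigr => j _.
  by rewrite rmorphM mulrACA.
rewrite exchange_big; apply: eq_bigr => i _ /=.
rewrite exchange_big /= normCK -(sum_delta i (fun j => a i * (a j)^*)).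
by apply: eq_bigr => j _; rewrite -mulr_sumr hu mulrC.
Qed.

Lemma spectral_sum_mulr (C : numClosedFieldType) (V : finType)
    (u : V -> V -> C) (d : V -> C) i x : unitary u ->
  \sum_y spectral_sum u d x y * (u i y)^* = d i * (u i x)^*.
Proof.
move=> [hu _]; under eq_bigr do rewrite mulr_suml.
rewrite exchange_big /= -(sum_delta i (fun j => d j * (u j x)^*)).
apply: eq_bigr => j _; under eq_bigr do rewrite -mulrA.
by rewrite -mulr_sumr hu eq_sym mulrC [_ * d j]mulrC.
Qed.

Lemma spectral_sum_mull (C : numClosedFieldType) (V : finType)
    (u : V -> V -> C) (d : V -> C) i y : unitary u ->
  \sum_x u i x * spectral_sum u d x y = d i * u i y.
Proof.
move=> [hu _]; under eq_bigr do rewrite mulr_sumr.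
rewrite exchange_big /= -(sum_delta i (fun j => d j * u j y)).
apply: eq_bigr => j _; under eq_bigr do rewrite !mulrA -mulrA.
by rewrite -mulr_suml hu.
Qed.

(* The transition matrix w between the two eigenbases satisfies
   d_i w_ij = e_j w_ij, hence phi(d_i) w_ij = phi(e_j) w_ij. *)
Lemma spectral_sum_calculus (C : numClosedFieldType) (V : finType)
    (u v : V -> V -> C) (d e phi_d phi_e : V -> C) :
  unitary u -> unitary v ->
  (forall i j, d i = e j -> phi_d i = phi_e j) ->
  (forall x y, spectral_sum u d x y = spectral_sum v e x y) ->
  forall x y, spectral_sum u phi_d x y = spectral_sum v phi_e x y.
Proof.
move=> hu hv hphi huv x y; pose w i j := \sum_z u i z * (v j z)^*.
(* Pair the common matrix with [u i] on the left and the conjugate of [v j] on the right: it acts by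
   [d i] on one and by [e j] on the other. *)
have dw i j : d i * w i j = e j * w i j.
  transitivity (\sum_z \sum_t u i z * spectral_sum u d z t * (v j t)^*).
    rewrite exchange_big /= mulr_sumr; apply: eq_bigr => t _.
    by rewrite -mulr_suml spectral_sum_mull // mulrA.
  rewrite mulr_sumr; apply: eq_bigr => z _; under eq_bigr do rewrite -mulrA huv.
  by rewrite -mulr_sumr spectral_sum_mulr // mulrCA.
have phiw i j : phi_d i * w i j = phi_e j * w i j.
  have /eqP := dw i j; rewrite -subr_eq0 -mulrBl mulf_eq0 subr_eq0.
  by case/orP=> /eqP; [move/hphi -> | move ->; rewrite !mulr0].
have uE i : u i y = \sum_j w i j * v j y.
  under eq_bigr do rewrite mulr_suml; rewrite exchange_big /=.
  under eq_bigr => z _ do (under eq_bigr do rewrite -mulrA;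
    rewrite -mulr_sumr (proj2 hv) eq_sym mulrC).
  by rewrite sum_delta.
have vE j : (v j x)^* = \sum_i (u i x)^* * w i j.
  under eq_bigr do rewrite mulr_sumr; rewrite exchange_big /=.
  under eq_bigr => z _ do (under eq_bigr do rewrite mulrA;
    rewrite -mulr_suml (proj2 hu)).
  by rewrite sum_delta.
rewrite /spectral_sum; under eq_bigr do rewrite uE mulr_sumr.
rewrite exchange_big; apply: eq_bigr => j _ /=.
rewrite vE !mulr_suml; apply: eq_bigr => i _.
by rewrite -!mulrA; congr (_ * _); rewrite !mulrA phiw [w i j * _]mulrC.
Qed.

(** * Spectral theorem over a finite index type *)

Lemma big_enum_rank (C : nmodType) (V : finType) (F : 'I_#|V| -> C) :
  \sum_i F i = \sum_(x : V) F (enum_rank x).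
Proof.
rewrite (reindex (fun x : V => enum_rank x)) //.
by exists enum_val => ? _; rewrite (enum_valK, enum_rankK).
Qed.

Lemma symmetric_spectral_sum (R : realType) (V : finType) (G : V -> V -> R) :
  (forall x y, G x y = G y x) ->
  exists (u : V -> V -> R[i]) (d : V -> R), unitary u /\
    forall x y, (G x y)%:C%C = spectral_sum u (fun i => (d i)%:C%C) x y.
Proof.
move=> Gsym.
pose A : 'M[R[i]]_#|V| := \matrix_(i, j) (G (enum_val i) (enum_val j))%:C%C.
have Areal : A \is a realmx.
  by apply/mxOverP => i j; rewrite mxE complex_real.
have Asym : A \is hermsymmx.
  apply: realsym_hermsym => //; apply/is_hermitianmxP.
  by rewrite expr0 scale1r; apply/matrixP => i j; rewrite !mxE Gsym.
have /orthomx_spectralP := hermitian_normalmx Asym.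
rewrite invmx_unitary ?spectral_unitarymx //.
have /mxOverP := hermitian_spectral_diag_real Asym.
have : spectralmx A \is unitarymx by exact: spectral_unitarymx.
move: (spectralmx A) (spectral_diag A) => P e Pu e_real AE.
exists (fun i x => P (enum_rank i) (enum_rank x)).
(* The eigenvalues are real ([e_real]), so [Re] loses nothing. *)
exists (fun i => complex.Re (e 0 (enum_rank i))); split.
  split=> [i j|x y].
    have /matrixP/(_ (enum_rank i) (enum_rank j)) := unitarymxP Pu.
    rewrite !mxE (inj_eq enum_rank_inj) => <-.
    by rewrite big_enum_rank; apply: eq_bigr => k _; rewrite !mxE.
  have /matrixP/(_ (enum_rank x) (enum_rank y)) := mulmx1C (unitarymxP Pu).
  rewrite !mxE (inj_eq enum_rank_inj) => <-.
  by rewrite big_enum_rank; apply: eq_bigr => k _; rewrite !mxE.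
move=> x y; have /matrixP/(_ (enum_rank x) (enum_rank y)) := AE.
rewrite !mxE !enum_rankK => ->; rewrite /spectral_sum.
rewrite big_enum_rank; apply: eq_bigr => k _; rewrite mul_mx_diag !mxE.
by rewrite RRe_real //; apply: e_real.
Qed.

(** * Norm estimates for spectral sums *)

Lemma spectral_sum_row (C : numClosedFieldType) (V : finType)
    (u : V -> V -> C) (d : V -> C) x : unitary u ->
  \sum_y `|spectral_sum u d x y| ^+ 2 = \sum_i `|d i| ^+ 2 * `|u i x| ^+ 2.
Proof.
move=> [hu _]; rewrite parseval //; apply: eq_bigr => i _.
by rewrite normrM norm_conjC exprMn mulrC.
Qed.

Lemma spectral_sum_frobenius (C : numClosedFieldType) (V : finType)
    (u : V -> V -> C) (d : V -> C) : unitary u ->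
  \sum_x \sum_y `|spectral_sum u d x y| ^+ 2 = \sum_i `|d i| ^+ 2.
Proof.
move=> hu; under eq_bigr do rewrite spectral_sum_row //.
rewrite exchange_big; apply: eq_bigr => i _ /=; rewrite -mulr_sumr.
under eq_bigr do rewrite normCK.
by rewrite (proj1 hu) eqxx mulr1.
Qed.

(** The form is diagonal in the coordinates [h f] and [h g], whose squared lengths are at most
    [#|V|] by Parseval for the transpose of [u]. *)
Lemma spectral_sum_form (C : numClosedFieldType) (V : finType)
    (u : V -> V -> C) (d f g : V -> C) (c : C) :
  unitary u -> 0 <= c -> (forall i, `|d i| <= c) ->
  (forall x, `|f x| <= 1) -> (forall x, `|g x| <= 1) ->
  `|\sum_x \sum_y (f x)^* * spectral_sum u d x y * g y| <= c * #|V|%:R.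
Proof.
move=> [_ hu] c0 dc f1 g1; pose h (f : V -> C) i := \sum_x f x * u i x.
have hle (f' : V -> C) : (forall x, `|f' x| <= 1) ->
    \sum_i `|h f' i| ^+ 2 <= #|V|%:R.
  move=> f'1; rewrite /h (@parseval _ _ (fun x i => u i x)); last first.
    move=> x y; under eq_bigr do rewrite mulrC.
    by rewrite hu eq_sym.
  rewrite -sum1_card natr_sum; apply: ler_sum => x _.
  by rewrite expr_le1.
have -> : \sum_x \sum_y (f x)^* * spectral_sum u d x y * g y =
          \sum_i (h f i)^* * d i * h g i.
  transitivity (\sum_x \sum_y \sum_i
      (f x * u i x)^* * d i * (g y * u i y)).
    apply: eq_bigr => x _; apply: eq_bigr => y _.
    rewrite mulr_sumr mulr_suml; apply: eq_bigr => i _.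
    by rewrite rmorphM /= -!mulrA [u i y * _]mulrC.
  under eq_bigr do rewrite exchange_big /=.
  rewrite exchange_big; apply: eq_bigr => i _ /=.
  rewrite /h rmorph_sum !mulr_suml; apply: eq_bigr => x _ /=.
  by rewrite mulr_sumr.
apply: (le_trans (ler_norm_sum _ _ _)).
(* AM-GM in each coordinate takes the place of Cauchy-Schwarz. *)
apply: (@le_trans _ _ (\sum_i c * ((`|h f i| ^+ 2 + `|h g i| ^+ 2) / 2))).
  apply: ler_sum => i _; rewrite !normrM norm_conjC mulrAC mulrC.
  apply: ler_pM => //; first by rewrite mulr_ge0.
  exact: (real_leif_mean_square (normr_real _) (normr_real _)).
rewrite -mulr_sumr ler_wpM2l // -mulr_suml big_split /=.
rewrite ler_pdivrMr ?ltr0n // mulr_natr mulr2n.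
by rewrite lerD ?hle.
Qed.

(** * Real functional calculus of a symmetric matrix *)

Lemma conj_real (R : realType) (r : R) : (r%:C%C : R[i])^* = r%:C%C.
Proof. exact: conjc_real. Qed.

Lemma norm_real (R : realType) (r : R) : `|r%:C%C : R[i]| = `|r|%:C%C.
Proof. by rewrite normc_def /= expr0n addr0 sqrtr_sqr. Qed.

Lemma sqr_norm_real (R : realType) (r : R) :
  `|r%:C%C : R[i]| ^+ 2 = (r ^+ 2)%:C%C.
Proof. by rewrite normCK conj_real -rmorphM. Qed.

Definition spectral_fun (R : realType) (V : finType) (u : V -> V -> R[i])
    (d : V -> R) (phi : R -> R) (x y : V) : R :=
  complex.Re (spectral_sum u (fun i => (phi (d i))%:C%C) x y).

Section SpectralFun.

Variables (R : realType) (V : finType) (u : V -> V -> R[i]) (d : V -> R).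
Variable G : V -> V -> R.
Hypothesis hu : unitary u.
Hypothesis hG :
  forall x y, (G x y)%:C%C = spectral_sum u (fun i => (d i)%:C%C) x y.
Implicit Types phi psi : R -> R.

(** Conjugating the eigenbasis diagonalizes the real matrix [G] again with the same eigenvalues, so
    phi(G) is its own conjugate and the projection [Re] is harmless. *)
Lemma spectral_funE phi x y : (spectral_fun u d phi x y)%:C%C =
  spectral_sum u (fun i => (phi (d i))%:C%C) x y.
Proof.
apply: RRe_real; apply/CrealP.
pose v i x := (u i x)^*.
have conj_sum e x' y' : (spectral_sum u (fun i => (e i)%:C%C) x' y')^* =
    spectral_sum v (fun i => (e i)%:C%C) x' y'.
  rewrite /spectral_sum rmorph_sum; apply: eq_bigr => i _.
  by rewrite !rmorphM /= conj_real.
rewrite conj_sum; symmetry.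
apply: (@spectral_sum_calculus _ _ _ _ (fun i => (d i)%:C%C)
  (fun i => (d i)%:C%C)) => //.
- split=> [i j|x' y'].
  + rewrite /v; under eq_bigr do rewrite conjCK mulrC.
    by rewrite (proj1 hu) eq_sym.
  + rewrite /v; under eq_bigr do rewrite conjCK mulrC.
    by rewrite (proj2 hu) eq_sym.
- by move=> i j /complexI ->.
- by move=> x' y'; rewrite -conj_sum -hG conj_real.
Qed.

Lemma spectral_fun_id x y : spectral_fun u d id x y = G x y.
Proof. by apply: complexI; rewrite spectral_funE hG. Qed.

Lemma spectral_funB phi psi x y :
  spectral_fun u d (fun r => phi r - psi r) x y =
  spectral_fun u d phi x y - spectral_fun u d psi x y.
Proof.
apply: complexI; rewrite rmorphB /= !spectral_funE /spectral_sum -sumrB.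
by apply: eq_bigr => i _; rewrite rmorphB mulrBr mulrBl.
Qed.

(** Permuting the coordinates of the eigenvectors by [g] gives another diagonalization of [G].
    Single eigenvectors may move, but phi(G) does not depend on the diagonalization. *)
Lemma spectral_fun_aut phi (g : {perm V}) :
  (forall x y, G (g x) (g y) = G x y) ->
  forall x y, spectral_fun u d phi (g x) (g y) = spectral_fun u d phi x y.
Proof.
move=> gG x y; apply: complexI; rewrite !spectral_funE.
pose v i x := u i (g x).
apply: (@spectral_sum_calculus _ _ v u (fun i => (d i)%:C%C)
  (fun i => (d i)%:C%C)) => //.
- split=> [i j|x' y'].
  + by rewrite -(proj1 hu) [RHS](reindex_inj (@perm_inj _ g)).
  + by rewrite (proj2 hu) (inj_eq perm_inj).
- by move=> i j /complexI ->.
- move=> x' y'; rewrite -hG -gG hG; exact: eq_bigr.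
Qed.

Lemma spectral_fun_frobenius phi :
  \sum_x \sum_y spectral_fun u d phi x y ^+ 2 = \sum_i phi (d i) ^+ 2.
Proof.
apply: complexI; rewrite !rmorph_sum.
under eq_bigr do (rewrite rmorph_sum; under eq_bigr do
  rewrite /= -sqr_norm_real spectral_funE).
rewrite spectral_sum_frobenius //; apply: eq_bigr => i _.
by rewrite sqr_norm_real.
Qed.

(** The left side is one term in the spectral expansion of the squared length of row [x] of [G]. *)
Lemma eigenvector_bound i x : (forall x y, `|G x y| <= 1) ->
  (d i ^+ 2)%:C%C * `|u i x| ^+ 2 <= #|V|%:R.
Proof.
move=> G1; apply: (@le_trans _ _ (\sum_y `|(G x y)%:C%C : R[i]| ^+ 2)).
  under eq_bigr do rewrite hG.
  rewrite spectral_sum_row // (bigD1 i) //= sqr_norm_real lerDl.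
  by apply: sumr_ge0 => j _; rewrite mulr_ge0 ?exprn_ge0.
rewrite -sum1_card natr_sum; apply: ler_sum => y _.
by rewrite sqr_norm_real lecR -real_normK ?num_real // expr_le1.
Qed.

Lemma spectral_fun_cut_norm phi c : (0 < #|V|)%N -> 0 <= c ->
  (forall i, `|phi (d i)| <= c) ->
  cut_norm (spectral_fun u d phi) <= c / #|V|%:R.
Proof.
move=> V0 c0 hc; apply: ge_sup.
  (* Bounding the supremum calls for a nonempty set; zero functions provide an element. *)
  exists 0, (fun=> 0), (fun=> 0); split; rewrite ?normr0 //.
  rewrite /cut_form big1 ?mulr0 ?normr0 //.
  by move=> x _; rewrite big1 // => y _; rewrite mulr0.
move=> r [f [g [f1 g1 ->]]].
rewrite -lecR RRe_real ?normr_real // /cut_form normrM.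
under eq_bigr do under eq_bigr do rewrite spectral_funE.
have N0 : 0 < #|V|%:R :> R[i] by rewrite ltr0n.
rewrite ger0_norm ?invr_ge0 ?exprn_ge0 // mulrC ler_pdivrMr ?exprn_gt0 //.
rewrite rmorphM /= fmorphV rmorph_nat expr2 mulrA divfK ?gt_eqF //.
apply: spectral_sum_form => //; first by rewrite lecR.
by move=> i; rewrite norm_real lecR.
Qed.

Lemma sum_sqr_eigenvalues : (forall x y, `|G x y| <= 1) ->
  \sum_i d i ^+ 2 <= #|V|%:R ^+ 2.
Proof.
move=> G1; have := spectral_fun_frobenius id; rewrite /= => <-.
rewrite expr2 -sum1_card natr_sum mulr_suml; apply: ler_sum => x _.
rewrite mul1r; apply: ler_sum => y _; rewrite spectral_fun_id.
by rewrite -real_normK ?num_real // expr_le1.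
Qed.

End SpectralFun.

(** * Step functions from finite codings *)

(** The blocks are the nonempty fibres of [f], and [S] samples [H] at one representative per fibre.
    So [S] is close to [H] as soon as [H] varies little on products of fibres. *)
Lemma kernel_step_function (R : realType) (V K : finType) (f : V -> K)
    (H : V -> V -> R) :
  exists (S : V -> V -> R) (s : nat),
    [/\ is_step_function s S, (s <= #|K|)%N &
     forall x y, exists x' y',
       [/\ f x' = f x, f y' = f y & S x y = H x' y']].
Proof.
pose r x := odflt x [pick z | f z == f x].
have fr x : f (r x) = f x.
  by rewrite /r; case: pickP => [z /eqP //|/(_ x)]; rewrite eqxx.
have rE x y : f x = f y -> r x = r y.
  by rewrite /r => ->; case: pickP => // /(_ y); rewrite eqxx.
pose pt := preim_partition f [set: V]%SET.
pose S x y := H (r x) (r y).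
have ptP : finset.partition pt [set: V]%SET by exact: preim_partitionP.
have ptE (i : 'I_#|pt|) a b :
    a \in (enum_val i : {set V}) -> b \in (enum_val i : {set V}) -> f a = f b.
  have /imsetP [c _ ->] := enum_valP i.
  by rewrite !inE /= => /eqP <- /eqP <-.
exists S, #|pt|; split.
(* Blocks are nonempty, so the default 0 is never reached. *)
- pose T (i j : 'I_#|pt|) : R :=
    match [pick a in (enum_val i : {set V})], [pick b in (enum_val j : {set V})]
    with Some a, Some b => S a b | _, _ => 0 end.
  exists (fun i => enum_val i), T; split.
  + exact: enum_val_inj.
  + suff -> : [set enum_val i | i : 'I_#|pt|]%SET = pt by [].
    apply/setP => A; apply/imsetP/idP => [[i _ ->]|Apt]; first exact: enum_valP.
    by exists (enum_rank_in Apt A); rewrite ?enum_rankK_in.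
  + move=> i j a b ai bj; rewrite /T.
    case: pickP => [a' a'i|/(_ a)]; last by rewrite ai.
    case: pickP => [b' b'j|/(_ b)]; last by rewrite bj.
    by rewrite /S (rE _ _ (ptE _ _ _ ai a'i)) (rE _ _ (ptE _ _ _ bj b'j)).
- pose fiber k : {set V} := [set x | f x == k]%SET.
  rewrite (leq_trans _ (leq_imset_card fiber K)) // subset_leq_card //.
  apply/fintype.subsetP => A /imsetP [x _ ->]; apply/imsetP; exists (f x) => //.
  by apply/setP => y; rewrite !inE /= eq_sym.
- by move=> x y; exists (r x), (r y); rewrite !fr.
Qed.

(** Rounding to a grid of mesh [delta]. *)
Lemma approx_code (R : realType) (L delta : R) : 0 < delta ->
  exists (K : finType) (code : R -> K), forall a b,
    `|a| <= L -> `|b| <= L -> code a = code b -> `|a - b| <= delta.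
Proof.
move=> delta0; pose h a := Num.truncn ((a + L) / delta).
(* On [-L, L] the index [h] stays within range, so [inord] is faithful there; nothing is claimed
   elsewhere. *)
exists 'I_(Num.truncn ((L + L) / delta)).+1, (fun a => inord (h a)).
move=> a b aL bL.
have h_ge0 c : `|c| <= L -> 0 <= (c + L) / delta.
  by rewrite ler_norml => /andP[? _]; rewrite divr_ge0 ?(ltW delta0) //; lra.
have h_lt c : `|c| <= L -> (h c < (Num.truncn ((L + L) / delta)).+1)%N.
  move=> cL; rewrite ltnS; apply: le_truncn.
  rewrite ler_pM2r ?invr_gt0 // lerD2r; move: cL; rewrite ler_norml.
  by case/andP.
move=> /(congr1 val); rewrite /= !inordK ?h_lt // => hab.
have /andP[a1 a2] := truncn_itv (h_ge0 a aL).
have /andP[b1 b2] := truncn_itv (h_ge0 b bL).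
rewrite -/(h a) -/(h b) in a1 a2 b1 b2.
rewrite hab in a1 a2.
have : `|(a + L) / delta - (b + L) / delta| <= 1.
  rewrite ler_norml; move: a2 b2; rewrite -natr1 => a2 b2.
  apply/andP; split; lra.
rewrite -mulrBl normrM normfV (gtr0_norm delta0) ler_pdivrMr // mul1r.
by rewrite opprD addrACA subrr addr0.
Qed.

Lemma approx_codeC (R : realType) (L delta : R) : 0 < delta ->
  exists (K : finType) (code : R[i] -> K), forall z w,
    `|z| <= L%:C%C -> `|w| <= L%:C%C -> code z = code w ->
    `|z - w| <= delta%:C%C.
Proof.
move=> delta0; have d2 : 0 < delta / 2 by rewrite divr_gt0.
have [K [code codeP]] := approx_code L d2.
exists (K * K)%type, (fun z => (code (complex.Re z), code (complex.Im z))).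
have ReL z : `|z| <= L%:C%C -> `|complex.Re z| <= L /\ `|complex.Im z| <= L.
  rewrite normc_def lecR => zL; rewrite -!sqrtr_sqr.
  by split; apply: le_trans zL; rewrite ler_wsqrtr // (lerDl, lerDr) sqr_ge0.
move=> z w /ReL[z1 z2] /ReL[w1 w2] [].
move=> /(codeP _ _ z1 w1) c1 /(codeP _ _ z2 w2) c2.
have -> : z - w = (complex.Re z - complex.Re w)%:C%C
    + 'i%C * (complex.Im z - complex.Im w)%:C%C.
  by rewrite {1}[z]complexE {1}[w]complexE !rmorphB /=; ring.
apply: (le_trans (ler_normD _ _)); rewrite normrM.
have -> : `|'i%C : R[i]| = 1 by rewrite normc_def /= expr0n add0r expr1n sqrtr1.
rewrite mul1r !norm_real -rmorphD lecR; lra.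
Qed.

Lemma conj_mul_close (C : numClosedFieldType) (a b a' b' L delta : C) :
  `|a| <= L -> `|b'| <= L -> `|a - a'| <= delta -> `|b - b'| <= delta ->
  `|a^* * b - a'^* * b'| <= 2 * L * delta.
Proof.
move=> aL bL aa bb.
have -> : a^* * b - a'^* * b' = a^* * (b - b') + (a - a')^* * b'.
  by rewrite rmorphB; ring.
apply: (le_trans (ler_normD _ _)); rewrite !normrM !norm_conjC.
have -> : 2 * L * delta = L * delta + delta * L by ring.
by apply: lerD; apply: ler_pM.
Qed.

(** * Step approximation of the dominant spectral part *)

Definition cutoff (R : realType) (c r : R) : R := if c <= `|r| then r else 0.

(** Vertices are grouped by their rounded coordinates along the large eigenvectors. The number and
    size of these are bounded in terms of [t], so [B] does not depend on [V] or [G]. *)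
Lemma spectral_step (R : realType) (t delta : R) : 0 < t -> 0 < delta ->
  exists B : nat, forall (V : finType) (u : V -> V -> R[i]) (d : V -> R)
      (G : V -> V -> R), (0 < #|V|)%N -> unitary u ->
    (forall x y, (G x y)%:C%C = spectral_sum u (fun i => (d i)%:C%C) x y) ->
    (forall x y, `|G x y| <= 1) ->
    exists (S : V -> V -> R) (s : nat), [/\ is_step_function s S, (s <= B)%N &
      forall x y,
        `|S x y - spectral_fun u d (cutoff (t * #|V|%:R)) x y| <= delta].
Proof.
(* At most t^-2 eigenvalues each contribute an error 2 t^-1 [delta'], for a total of [delta]. *)
move=> t0 delta0; pose delta' := delta * t ^+ 3 / 2.
have delta'0 : 0 < delta' by rewrite divr_gt0 ?mulr_gt0 ?exprn_gt0.
have [K [code codeP]] := approx_codeC t^-1 delta'0.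
pose k := Num.truncn (t ^- 2).
exists (#|K| ^ k)%N => V u d G V0 hu hG G1; set N : R := #|V|%:R.
have N0 : 0 < N by rewrite ltr0n.
have sum_d := sum_sqr_eigenvalues hu hG G1.
have d_le i : `|d i| <= N.
  rewrite -(@ler_pXn2r _ 2) ?nnegrE // ?(ltW N0) // real_normK ?num_real //.
  apply: le_trans sum_d; rewrite (bigD1 i) //= lerDl.
  by apply: sumr_ge0 => j _; apply: sqr_ge0.
pose I := [set i | t * N <= `|d i|]%SET.
(* Each index in [I] contributes at least (tN)^2 to a sum bounded by N^2. *)
have cardI : #|I|%:R <= t ^- 2.
  rewrite -[t ^- 2]mul1r ler_pdivlMr ?exprn_gt0 //.
  rewrite -(@ler_pM2r _ (N ^+ 2)) ?exprn_gt0 // mul1r.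
  apply: le_trans sum_d; rewrite -mulrA -exprMn -sum1_card natr_sum mulr_suml.
  rewrite [leRHS](bigID (mem I)) /= -[leLHS]addr0 lerD //; last first.
    by apply: sumr_ge0 => j _; apply: sqr_ge0.
  apply: ler_sum => i; rewrite inE mul1r => ti.
  rewrite -[d i ^+ 2]real_normK ?num_real // ler_pXn2r ?nnegrE //.
  by rewrite mulr_ge0 // ltW.
(* Eigenvectors normalized for the uniform probability measure. *)
pose w i x := (Num.sqrt N)%:C%C * u i x.
pose f x := [ffun i : {i | i \in I} => code (w (val i) x)].
(* From d_i^2 |u_i(x)|^2 <= N and |d_i| >= tN follows N |u_i(x)|^2 <= t^-2. *)
have w_le i x : i \in I -> `|w i x| <= (t^-1)%:C%C.
  rewrite inE => ti; rewrite fmorphV /= -[leRHS]mul1r ler_pdivlMr ?ltcR //.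
  have NC0 : 0 < N%:C%C :> R[i] by rewrite ltcR.
  have tC0 : 0 <= t%:C%C :> R[i] by rewrite ler0c ltW.
  rewrite -(@expr_le1 _ 2) ?mulr_ge0 // exprMn normrM exprMn.
  rewrite sqr_norm_real sqr_sqrtr ?(ltW N0) // -(@ler_pM2r _ N%:C%C) // mul1r.
  have -> : N%:C%C * `|u i x| ^+ 2 * t%:C%C ^+ 2 * N%:C%C =
      ((t * N) ^+ 2)%:C%C * `|u i x| ^+ 2.
    by rewrite rmorphXn rmorphM /=; ring.
  have := eigenvector_bound hu hG i x G1.
  rewrite -(rmorph_nat (real_complex R)) -/N; apply: le_trans.
  rewrite ler_wpM2r ?exprn_ge0 // lecR -[d i ^+ 2]real_normK ?num_real //.
  by rewrite ler_pXn2r ?nnegrE ?mulr_ge0 // ltW.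
have [S [s [stepS leS SE]]] := kernel_step_function f
  (spectral_fun u d (cutoff (t * N))).
exists S, s; split => //.
  apply: (leq_trans leS); rewrite card_ffun card_sig.
  (* Monotonicity in the exponent needs [K] nonempty, witnessed by [code 0]. *)
  rewrite leq_pexp2l //; first by apply/card_gt0P; exists (code 0).
  by rewrite /k truncn_ge_nat // invr_ge0 exprn_ge0 // ltW.
move=> x y; have [x' [y' [fx fy ->]]] := SE x y.
rewrite -lecR -norm_real rmorphB /= !(spectral_funE hu hG) /spectral_sum.
rewrite -sumrB.
have wc i z z' : i \in I -> f z' = f z -> `|w i z' - w i z| <= delta'%:C%C.
  move=> iI /ffunP /(_ (exist _ i iI)); rewrite !ffunE /=.
  by move/codeP; apply; apply: w_le.
apply: (le_trans (ler_norm_sum _ _ _)).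
apply: (@le_trans _ _ (\sum_(i in I) (2 * (t^-1)%:C%C * delta'%:C%C : R[i]))).
  rewrite [leRHS]big_mkcond /=; apply: ler_sum => i _.
  rewrite /cutoff inE; case: ifP => [ti|_]; last first.
    by rewrite !mulr0 !mul0r subrr normr0.
  have iI : i \in I by rewrite inE.
  (* Since |d_i| <= N, the eigenvalue is absorbed by the two factors sqrt N in [w]. *)
  apply: (@le_trans _ _ `|(w i x')^* * w i y' - (w i x)^* * w i y|); last first.
    by apply: conj_mul_close; rewrite ?w_le ?wc.
  have -> : (w i x')^* * w i y' - (w i x)^* * w i y =
      N%:C%C * ((u i x')^* * u i y' - (u i x)^* * u i y).
    rewrite -[N in RHS]sqr_sqrtr ?(ltW N0) // rmorphXn /= /w !rmorphM /=.
    rewrite conj_real; ring.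
  have -> : (u i x')^* * (d i)%:C%C * u i y' - (u i x)^* * (d i)%:C%C * u i y =
      (d i)%:C%C * ((u i x')^* * u i y' - (u i x)^* * u i y) by ring.
  rewrite !normrM ler_wpM2r // !norm_real lecR.
  by rewrite [leRHS]ger0_norm ?(ltW N0).
rewrite sumr_const -[_ *+ #|I|]mulr_natr -(rmorph_nat (real_complex R) #|I|).
rewrite -(rmorph_nat (real_complex R) 2) -!rmorphM lecR.
have -> : delta = 2 * t^-1 * delta' * t ^- 2.
  by rewrite /delta'; field; rewrite gt_eqF.
by rewrite ler_pM2l // !mulr_gt0 ?invr_gt0.
Qed.

(** * Choice of the scale and the decomposition *)

(** If all increments exceeded [c], telescoping would give W J - W 0 > cJ. *)
Lemma increment_pigeonhole (R : realFieldType) (W : nat -> R) (J : nat)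
    (c : R) :
  (0 < J)%N -> 0 <= W 0%N -> W J <= c * J%:R ->
  exists2 j, (j < J)%N & W j.+1 - W j <= c.
Proof.
move=> J0 W0 WJ; apply: contrapT => no.
have : c * J%:R < \sum_(0 <= j < J) (W j.+1 - W j).
  rewrite mulr_natr -[in ltLHS](card_ord J) -sumr_const big_mkord.
  apply: ltr_sum => [|j _].
    by apply/hasP; exists (Ordinal J0); rewrite ?mem_index_enum.
  by rewrite ltNge; apply/negP => le; apply: no; exists j.
by rewrite telescope_sumr //; lra.
Qed.

Lemma perm_conjE (R : realType) (V : finType) (g : {perm V})
    (M : V -> V -> R) x y : perm_conj g M x y = M (g x) (g y).
Proof.
rewrite /perm_conj /fmulmx /fperm_mx (bigD1 (g y)) //= permK eqxx mulr1.
rewrite sum_delta big1 ?addr0 // => z zy.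
by rewrite -(inj_eq (@perm_inj _ g)) permKV (negPf zy) mulr0.
Qed.

Theorem theorem3 (R : realType) (F : R -> nat -> R)
    (hF : positive_decreasing F) (eps : R) (heps : 0 < eps) :
  exists n : nat,
    forall (V : finType) (G : V -> V -> R),
      (0 < #|V|)%N ->
      (forall x y : V, G x y = G y x) ->
      (forall x y : V, -1 <= G x y <= 1) ->
      exists (S E Q : V -> V -> R) (s : nat),
        (forall x y : V, G x y = S x y + E x y + Q x y) /\
        [/\ is_step_function s S /\ (s <= n)%N,
            forall g : {perm V}, mx_aut G g ->
              mx_norm_inf (fun x y => perm_conj g S x y - S x y) <= eps,
            mx_norm2 E <= eps &
            cut_norm Q <= F eps s].
Proof.
case: hF => F_gt0 _ F_decr.
have eps2 : 0 < eps / 2 by rewrite divr_gt0.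
have /choice[B BP] (t : {t : R | 0 < t}) := spectral_step (svalP t) eps2.
have next_gt0 (t : {t : R | 0 < t}) : 0 < Num.min (val t) (F eps (B t)).
  by rewrite lt_min (svalP t) F_gt0.
(* The threshold [F eps (B t)] serves the cut norm; the minimum with [t] keeps the thresholds
   nonincreasing, hence the spectral parts nested. *)
pose tau j : {t : R | 0 < t} :=
  iter j (fun t => Sub (Num.min (val t) (F eps (B t))) (next_gt0 t))
    (Sub 1 (@ltr01 R)).
(* [W] never exceeds N^2, and J increments of N^2 (eps/2)^2 reach N^2 once J >= 4 / eps^2. *)
pose J := (Num.truncn (4 / eps ^+ 2)).+1.
(* The scale [j] will depend on [G], hence the maximum. *)
exists (\max_(j < J) B (tau j)) => V G V0 Gsym G1.
have normG x y : `|G x y| <= 1 by rewrite ler_norml.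
have [u [d [hu hG]]] := symmetric_spectral_sum Gsym.
set N : R := #|V|%:R in BP *.
have N0 : 0 < N by rewrite ltr0n.
pose chi j := cutoff (val (tau j) * N).
(* The squared Frobenius norm of the spectral part at scale [j]. *)
pose W j := \sum_i chi j (d i) ^+ 2.
have tau_le j : val (tau j.+1) <= val (tau j) by rewrite /= ge_min lexx.
have [j jJ Wj] : exists2 j, (j < J)%N & W j.+1 - W j <= N ^+ 2 * (eps / 2) ^+ 2.
  apply: increment_pigeonhole => //.
    by apply: sumr_ge0 => i _; apply: sqr_ge0.
  apply: (@le_trans _ _ (N ^+ 2)).
    apply: (@le_trans _ _ (\sum_i d i ^+ 2)).
      apply: ler_sum => i _; rewrite /chi /cutoff; case: ifP => // _.
      by rewrite expr0n sqr_ge0.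
    exact: sum_sqr_eigenvalues hu hG normG.
  rewrite -mulrA -[leLHS]mulr1 ler_wpM2l ?sqr_ge0 //.
  have /ltW : 4 / eps ^+ 2 < J%:R by rewrite truncnS_gt.
  by rewrite ler_pdivrMr ?exprn_gt0 //; lra.
have [S [s [stepS leS SP]]] := BP (tau j) V u d G V0 hu hG normG.
pose P k := spectral_fun u d (chi k).
pose Q := spectral_fun u d (fun r => r - chi j.+1 r).
(* [E] collects the spectral increment, small in L2, and the step approximation error, at most eps/2
   entrywise. *)
exists S, (fun x y => (P j.+1 x y - P j x y) + (P j x y - S x y)), Q, s.
split.
  move=> x y; rewrite /Q (spectral_funB hu hG) (spectral_fun_id hu hG) /P.
  by ring.
split.
- split=> //; apply: (leq_trans leS).
  exact: (leq_bigmax (Ordinal jJ)).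
- move=> g gG; apply: bigmax_le => [|[x y] _ /=]; first exact: ltW.
  (* [S] is within eps/2 of the invariant matrix [P j] both at (x, y) and at (g x, g y). *)
  rewrite perm_conjE; have := SP x y; have := SP (g x) (g y).
  rewrite (spectral_fun_aut hu hG) => [|x' y']; last by rewrite -perm_conjE gG.
  rewrite !ler_norml => /andP[? ?] /andP[? ?]; apply/andP; split; lra.
- rewrite /mx_norm2 -[leRHS]ger0_norm ?(ltW heps) // -sqrtr_sqr.
  rewrite ler_wsqrtr // mulrC ler_pdivrMr ?exprn_gt0 //.
  pose M x y := P j.+1 x y - P j x y.
  (* By (a + b)^2 <= 2 a^2 + 2 b^2; each of the two terms then uses half of eps^2 N^2. *)
  apply: (@le_trans _ _ (\sum_x \sum_y (2 * M x y ^+ 2 + 2 * (eps / 2) ^+ 2))).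
    apply: ler_sum => x _; apply: ler_sum => y _.
    rewrite real_normK ?num_real // -/(M x y) -/P.
    have : (P j x y - S x y) ^+ 2 <= (eps / 2) ^+ 2.
      rewrite -real_normK ?num_real // ler_pXn2r ?nnegrE ?(ltW eps2) //.
      by rewrite distrC SP.
    have := sqr_ge0 (M x y - (P j x y - S x y)); lra.
  (* Nested cutoffs differ by [d i] or 0, so the square of the difference is the difference of the
     squares; [le_tau] excludes the case of passing only the larger threshold. *)
  have MW : \sum_x \sum_y M x y ^+ 2 = W j.+1 - W j.
    under eq_bigr do under eq_bigr do rewrite /M /P -(spectral_funB hu hG).
    rewrite (spectral_fun_frobenius hu hG) /W -sumrB; apply: eq_bigr => i _.
    have /(ler_wpM2r (ltW N0)) le_tau := tau_le j.
    rewrite /chi /cutoff; case: ifP => ti; case: ifP => tj //; last by ring.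
    - by ring.
    - by ring.
    - by rewrite (le_trans le_tau tj) in ti.
  under eq_bigr do rewrite big_split -mulr_sumr sumr_const.
  rewrite big_split -mulr_sumr MW sumr_const /=.
  have -> : eps ^+ 2 * N ^+ 2 = 2 * (N ^+ 2 * (eps / 2) ^+ 2)
      + 2 * (eps / 2) ^+ 2 * N * N by field.
  by rewrite /N !mulr_natr lerD2r ler_pM2l.
(* As s <= B (tau j) and [F] is decreasing in its second variable, tau (j+1) <= F eps (B (tau j)) <=
   F eps s. *)
- apply: (@le_trans _ _ (val (tau j.+1))); last first.
    by rewrite /= ge_min F_decr ?orbT.
  rewrite -[leRHS](mulfK (lt0r_neq0 N0)).
  apply: (spectral_fun_cut_norm hu hG) => //.
    by rewrite mulr_ge0 ?(ltW N0) // ltW // (svalP (tau j.+1)).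
  move=> i; rewrite /chi /cutoff; case: ifP => [_|/negbT].
    by rewrite subrr normr0 mulr_ge0 ?(ltW N0) // ltW // (svalP (tau j.+1)).
  by rewrite -ltNge subr0 => /ltW.
Qed.
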